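(* Let $\phi:\mathbb R^n\to\mathbb R$ and $h:\mathbb R^n\to\mathbb R^m$ be smooth (continuously differentiable), let $C\subset\mathbb R^m$ be a nonempty closed convex set, and consider the problem of minimizing $\phi(x)$ subject to $h(x)\in C$. Let $$s_f(x,\mu):=\phi(x)+\frac1{2\mu}\operatorname{dist}^2(h(x)\mid C)\qquad(\mu>0),$$ and let $f(x):=\phi(x)+\delta(h(x)\mid C)$. Let $\{x^k\}\subset\mathbb R^n$ and $\{\mu_k\}\downarrow0$ satisfy $\|\nabla_xs_f(x^k,\mu_k)\|\downarrow0$. Then every feasible cluster point $\bar x$ of $\{x^k\}$ (i.e. $h(\bar x)\in C$) at which $$\operatorname{nul}h'(\bar x)^T\cap N(h(\bar x)\mid C)=\{0\}$$ is a Karush–Kuhn–Tucker point of the problem, i.e. $$0\in\partial f(\bar x)=\nabla\phi(\bar x)+h'(\bar x)^TN(h(\bar x)\mid C).$$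
   Context: $\operatorname{dist}(y\mid C)=\inf_{z\in C}\|y-z\|$ (Euclidean). $\delta(y\mid C)=0$ if $y\in C$ and $+\infty$ otherwise. $h'$ is the Jacobian; $\operatorname{nul}$ denotes null space. For $\bar y\in C$, $N(\bar y\mid C)=\{v\mid v^T(y-\bar y)\le0\ \forall y\in C\}$. $\mu_k\downarrow0$ means $\mu_k>0$, $\mu_k\to0$; for the gradient norms, $\downarrow 0$ means convergence to $0$ from above. $\partial f$ is the limiting subdifferential: with $\hat\partial f(x)=\{v\mid f(z)\ge f(x)+v^T(z-x)+o(\|z-x\|)\}$ for $f(x)<+\infty$, $\partial f(\bar x)$ is the set of all $v$ for which there exist $x^k\to\bar x$ with $f(x^k)\to f(\bar x)$ and $v^k\in\hat\partial f(x^k)$ with $v^k\to v$. *)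

(* Defs.v *)
From HB Require Import structures.
From mathcomp Require Import all_boot all_order all_algebra.
From mathcomp Require Import all_classical all_reals all_analysis.

Set Implicit Arguments.
Unset Strict Implicit.
Unset Printing Implicit Defensive.

Import Order.TTheory GRing.Theory Num.Theory.
Import numFieldNormedType.Exports.

Local Open Scope classical_set_scope.
Local Open Scope ring_scope.

(* Vectors of R^n are row vectors.  The norm that MathComp-Analysis puts on
   'rV[R]_n is the sup norm, hence the separate Euclidean norm [enorm]; both
   induce the same topology. *)
Definition dotv (R : realType) (n : nat) (u v : 'rV[R]_n) : R :=
  \sum_(i < n) u 0 i * v 0 i.

Definition enorm (R : realType) (n : nat) (v : 'rV[R]_n) : R :=
  Num.sqrt (dotv v v).

(* The product A v of a matrix with a vector, the latter being stored as a row: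
   (A v)^T = v^T A^T. *)
Definition mxapp (R : realType) (p q : nat) (A : 'M[R]_(p, q)) (v : 'rV[R]_q)
  : 'rV[R]_p := v *m A^T.

Definition nul (R : realType) (p q : nat) (A : 'M[R]_(p, q)) : set 'rV[R]_q :=
  [set v | mxapp A v = 0].

Definition grad (R : realType) (n : nat) (g : 'rV[R]_n -> R) (x : 'rV[R]_n)
  : 'rV[R]_n := \row_(i < n) 'D_(delta_mx 0 i) g x.

(* The usual m x n Jacobian h'(x): the library's ['J h x] acts on row vectors
   from the right and is therefore its transpose. *)
Definition jac (R : realType) (n m : nat) (h : 'rV[R]_n -> 'rV[R]_m)
  (x : 'rV[R]_n) : 'M[R]_(m, n) := ('J h x)^T.

Definition dist (R : realType) (m : nat) (C : set 'rV[R]_m) (y : 'rV[R]_m) : R :=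
  inf [set enorm (y - z) | z in C].

Definition delta (R : realType) (m : nat) (C : set 'rV[R]_m) (y : 'rV[R]_m)
  : \bar R := if y \in C then 0%E else +oo%E.

Definition normal_cone (R : realType) (m : nat) (C : set 'rV[R]_m)
  (ybar : 'rV[R]_m) : set 'rV[R]_m :=
  [set v | forall y, C y -> dotv v (y - ybar) <= 0].

Definition regular_subdiff (R : realType) (n : nat) (f : 'rV[R]_n -> \bar R)
  (x : 'rV[R]_n) : set 'rV[R]_n :=
  [set v | (f x < +oo)%E /\
    exists2 r : 'rV[R]_n -> R,
      r =o_x (fun z => enorm (z - x)) &
      \forall z \near x, (f x + (dotv v (z - x) + r z)%:E <= f z)%E].

Definition limiting_subdiff (R : realType) (n : nat) (f : 'rV[R]_n -> \bar R)
  (xbar : 'rV[R]_n) : set 'rV[R]_n :=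
  [set v | exists (x : nat -> 'rV[R]_n) (w : nat -> 'rV[R]_n),
    [/\ x k @[k --> \oo] --> xbar,
        f (x k) @[k --> \oo] --> f xbar,
        forall k, regular_subdiff f (x k) (w k) &
        w k @[k --> \oo] --> v]].

Definition penalty (R : realType) (n m : nat) (phi : 'rV[R]_n -> R)
  (h : 'rV[R]_n -> 'rV[R]_m) (C : set 'rV[R]_m) (mu : R) (x : 'rV[R]_n) : R :=
  phi x + (2 * mu)^-1 * dist C (h x) ^+ 2.

Definition constrained (R : realType) (n m : nat) (phi : 'rV[R]_n -> R)
  (h : 'rV[R]_n -> 'rV[R]_m) (C : set 'rV[R]_m) (x : 'rV[R]_n) : \bar R :=
  ((phi x)%:E + delta C (h x))%E.

(* Main.v *)
Require Import Defs.
From HB Require Import structures.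
From mathcomp Require Import all_boot all_order all_algebra.
From mathcomp Require Import all_classical all_reals all_analysis.
From mathcomp Require Import ring lra.
Import Order.TTheory GRing.Theory Num.Theory.
Import numFieldNormedType.Exports.
Set Implicit Arguments.
Unset Strict Implicit.
Unset Printing Implicit Defensive.
Local Open Scope classical_set_scope.
Local Open Scope ring_scope.

(** Two facts carry the proof.

    The first is a closedness property ([multiplier_closure]): if [A k -> B],
    [p k -> q], [y k] is normal to [C] at [p k] and [A k (y k) -> v], then [v]
    is [B w] for some [w] normal to [C] at [q], as soon as no nonzero normal at
    [q] is in the null space of [B].  Normal cones to a convex set are closed
    under limits, so it is enough that [y k] stays bounded along a subsequence;
    otherwise the normalized [y k] would produce a nonzero normal in the null
    space.

    The second is a gradient computation: the squared distance to [C] is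
    differentiable with gradient twice the residual [y - p], where [p] is the
    projection of [y], and this residual is normal to [C] at [p]
    ([dist_sqr_is_diff]).  Hence the gradient of the penalty function at [x k]
    is [grad phi (x k) + h'(x k)^T (y k)] with [y k = (h (x k) - p k) / mu k]
    normal to [C] at the projection [p k] of [h (x k)].  Along a subsequence
    [x k -> xbar] the projections tend to [h xbar], because [h xbar] is in [C],
    and the gradients tend to zero, so closedness gives a multiplier [y] at [xbar] with
    [grad phi xbar + h'(xbar)^T y = 0].

    It remains to prove the formula for the subdifferential of
    [f = phi + delta(h(.)|C)].  A vector [grad phi xbar + h'(xbar)^T y] with [y]
    normal is a regular subgradient, because [phi + y.(h - h xbar)] is a smooth
    minorant of [f] touching it at [xbar] ([multiplier_regular_subdiff]).
    Conversely, let [v] be a limit of regular subgradients [w k] at points [u k].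
    The vectors [w k - grad phi (u k)] are regular normals to [h^-1(C)]; the
    constraint qualification is only assumed at [xbar], so exact multipliers at
    [u k] are not sought.  The penalty method itself, applied locally around
    [u k], gives approximate multipliers with arbitrarily small error at nearby
    points ([regular_normal_multiplier]), and closedness makes them exact in the
    limit. *)

(** * Euclidean geometry of row vectors *)

Section Euclidean.
Context {R : realType}.

Section Dot.
Context {n : nat}.
Implicit Types (u v w : 'rV[R]_n) (a : R).

Lemma dotvE u v : dotv u v = (u *m v^T) 0 0.
Proof. by rewrite mxE; apply: eq_bigr => i _; rewrite mxE. Qed.

Lemma dotvC u v : dotv u v = dotv v u.
Proof. by apply: eq_bigr => i _; rewrite mulrC. Qed.

Lemma dotvDl u v w : dotv (u + v) w = dotv u w + dotv v w.
Proof. by rewrite !dotvE mulmxDl mxE. Qed.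

Lemma dotvZl a u v : dotv (a *: u) v = a * dotv u v.
Proof. by rewrite !dotvE -scalemxAl mxE. Qed.

Lemma dotvNl u v : dotv (- u) v = - dotv u v.
Proof. by rewrite -scaleN1r dotvZl mulN1r. Qed.

Lemma dotvBl u v w : dotv (u - v) w = dotv u w - dotv v w.
Proof. by rewrite dotvDl dotvNl. Qed.

Lemma dotvDr u v w : dotv w (u + v) = dotv w u + dotv w v.
Proof. by rewrite !(dotvC w) dotvDl. Qed.

Lemma dotvZr a u v : dotv u (a *: v) = a * dotv u v.
Proof. by rewrite !(dotvC u) dotvZl. Qed.

Lemma dotvNr u v : dotv u (- v) = - dotv u v.
Proof. by rewrite !(dotvC u) dotvNl. Qed.

Lemma dotvBr u v w : dotv w (u - v) = dotv w u - dotv w v.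
Proof. by rewrite dotvDr dotvNr. Qed.

Lemma dotv0r u : dotv u 0 = 0.
Proof. by rewrite dotvE trmx0 mulmx0 mxE. Qed.

Lemma dotv0l u : dotv 0 u = 0.
Proof. by rewrite dotvC dotv0r. Qed.

Lemma dotvv_ge0 u : 0 <= dotv u u.
Proof. by apply: sumr_ge0 => i _; rewrite -expr2 sqr_ge0. Qed.

Lemma dotv_sqrD u v : dotv (u + v) (u + v) = dotv u u + 2 * dotv u v + dotv v v.
Proof. by rewrite dotvDl !dotvDr (dotvC v u); ring. Qed.

Lemma dotv_sqrB u v : dotv (u - v) (u - v) = dotv u u - 2 * dotv u v + dotv v v.
Proof. by rewrite dotv_sqrD !dotvNr dotvNl; ring. Qed.

Lemma dotv_delta u i : dotv u (delta_mx 0 i) = u 0 i.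
Proof.
rewrite /dotv (bigD1 i)//= mxE !eqxx mulr1 big1 ?addr0// => j ji.
by rewrite mxE (negbTE ji) mulr0.
Qed.

Lemma enorm_ge0 u : 0 <= enorm u.
Proof. exact: sqrtr_ge0. Qed.

Lemma enorm_sqr u : enorm u ^+ 2 = dotv u u.
Proof. by rewrite sqr_sqrtr// dotvv_ge0. Qed.

Lemma enormN u : enorm (- u) = enorm u.
Proof. by rewrite /enorm dotvNl dotvNr opprK. Qed.

Lemma enormBC u v : enorm (u - v) = enorm (v - u).
Proof. by rewrite -enormN opprB. Qed.

Lemma enorm0 : enorm (0 : 'rV[R]_n) = 0.
Proof. by rewrite /enorm dotv0l sqrtr0. Qed.

Lemma enormZ a u : enorm (a *: u) = `|a| * enorm u.
Proof.
by rewrite /enorm dotvZl dotvZr mulrA sqrtrM ?sqr_ge0// -expr2 sqrtr_sqr.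
Qed.

(** The norm [`|u|] is the largest entry in absolute value; this bound and
    [enorm_le_norm] transfer limits between the two norms. *)
Lemma norm_le_enorm u : `|u| <= enorm u.
Proof.
rewrite [leLHS]/Num.norm/= mx_normrE; apply/bigmax_leP; split => [|[i j] _/=].
  exact: enorm_ge0.
rewrite ord1 -sqrtr_sqr; apply: ler_wsqrtr.
rewrite /dotv (bigD1 j)//= -expr2 lerDl.
by apply: sumr_ge0 => k _; rewrite -expr2 sqr_ge0.
Qed.

Lemma coord_le_norm u i : `|u 0 i| <= `|u|.
Proof.
rewrite [leRHS]/Num.norm/= mx_normrE.
by apply/bigmax_geP; right => /=; exists (0, i).
Qed.

Lemma enorm_le_norm u : enorm u <= Num.sqrt n%:R * `|u|.
Proof.
rewrite -[`|u|]ger0_norm// -sqrtr_sqr -sqrtrM// ler_wsqrtr//.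
have -> : n%:R * `|u| ^+ 2 = \sum_(i < n) `|u| ^+ 2.
  by rewrite sumr_const card_ord mulr_natl.
apply: ler_sum => i _; rewrite -expr2 -[leLHS]real_normK ?num_real//.
by rewrite lerXn2r ?nnegrE ?coord_le_norm.
Qed.

Lemma enorm_eq0 u : enorm u = 0 -> u = 0.
Proof.
by move=> u0; apply/eqP; rewrite -normr_le0 -u0 norm_le_enorm.
Qed.

(** Cauchy-Schwarz, from the nonnegativity of the squared norm of
    [|v| u - |u| v]. *)
Lemma dotv_le_enorm u v : dotv u v <= enorm u * enorm v.
Proof.
have [/eqP u0|u0] := boolP (enorm u == 0).
  by rewrite (enorm_eq0 u0) dotv0l enorm0 mul0r.
have [/eqP v0|v0] := boolP (enorm v == 0).
  by rewrite (enorm_eq0 v0) dotv0r enorm0 mulr0.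
have uv : 0 < enorm u * enorm v by rewrite mulr_gt0// lt0r ?u0 ?v0 enorm_ge0.
have := dotvv_ge0 (enorm v *: u - enorm u *: v).
rewrite dotv_sqrB !dotvZl !dotvZr -!enorm_sqr => uv0.
rewrite -subr_ge0 -(pmulr_rge0 _ uv); nra.
Qed.

Lemma enorm_triangle u v : enorm (u + v) <= enorm u + enorm v.
Proof.
rewrite -(@ler_pXn2r _ 2) ?nnegrE ?addr_ge0 ?enorm_ge0//.
rewrite enorm_sqr dotv_sqrD sqrrD -!enorm_sqr.
have := dotv_le_enorm u v; lra.
Qed.

End Dot.

Lemma cvg_sum_ord {p : nat} {T : Type} {F : set_system T} {FF : Filter F}
    (f : 'I_p -> T -> R) (a : 'I_p -> R) :
  (forall i, f i t @[t --> F] --> a i) ->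
  \sum_(i < p) f i t @[t --> F] --> \sum_(i < p) a i.
Proof.
move=> fa; apply: (@cvg_big _ _ +%R 0 xpredT) => [|i _]; last exact: fa.
exact: add_continuous.
Qed.

Lemma cvg_coord {p q : nat} {T : Type} {F : set_system T} {FF : Filter F}
    (A : T -> 'M[R]_(p, q)) (B : 'M[R]_(p, q)) i j :
  A t @[t --> F] --> B -> A t i j @[t --> F] --> B i j.
Proof. by 
move=> AB; exact: (continuous_cvg _ (@coord_continuous R p q i j B) AB). Qed.

Lemma cvg_dotv {n : nat} {T : Type} {F : set_system T} {FF : Filter F}
    (u v : T -> 'rV[R]_n) (a b : 'rV[R]_n) :
  u t @[t --> F] --> a -> v t @[t --> F] --> b ->
  dotv (u t) (v t) @[t --> F] --> dotv a b.
Proof.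
move=> ua vb; apply: cvg_sum_ord => i.
by apply: cvgM; exact: cvg_coord.
Qed.

Lemma cvg_enorm {n : nat} {T : Type} {F : set_system T} {FF : Filter F}
    (u : T -> 'rV[R]_n) (a : 'rV[R]_n) :
  u t @[t --> F] --> a -> enorm (u t) @[t --> F] --> enorm a.
Proof.
move=> ua; 
exact: (continuous_cvg _ (@sqrt_continuous R (dotv a a)) (cvg_dotv ua ua)).
Qed.

Lemma cvg_enorm0 {n : nat} {T : Type} {F : set_system T} {FF : Filter F}
    (u : T -> 'rV[R]_n) (a : 'rV[R]_n) :
  enorm (u t - a) @[t --> F] --> 0 -> u t @[t --> F] --> a.
Proof.
move=> ua; apply/cvgrPdist_le => e e0.
move/cvgr0Pnorm_le : ua => /(_ e e0).
apply: filterS => t ut; rewrite distrC (le_trans (norm_le_enorm _))//.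
by rewrite (le_trans (ler_norm _)).
Qed.

Lemma cvg_mxP {p q : nat} {T : Type} {F : set_system T} {FF : Filter F}
    (A : T -> 'M[R]_(p, q)) (B : 'M[R]_(p, q)) :
  (forall i j, A t i j @[t --> F] --> B i j) -> A t @[t --> F] --> B.
Proof.
move=> AB U [P BP PU]; apply: (filterS (fun t => PU (A t))).
by apply: filter_forall => i; apply: filter_forall => j; apply: AB.
Qed.

Lemma cvg_trmx {p q : nat} {T : Type} {F : set_system T} {FF : Filter F}
    (A : T -> 'M[R]_(p, q)) (B : 'M[R]_(p, q)) :
  A t @[t --> F] --> B -> (A t)^T @[t --> F] --> B^T.
Proof.
move=> AB; apply: cvg_mxP => i j; rewrite mxE.
by under eq_fun do rewrite mxE; exact: cvg_coord.
Qed.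

Lemma cvg_mulmx {p q : nat} {T : Type} {F : set_system T} {FF : Filter F}
    (A : T -> 'M[R]_(p, q)) (v : T -> 'rV[R]_p) (B : 'M[R]_(p, q))
    (b : 'rV[R]_p) :
  v t @[t --> F] --> b -> A t @[t --> F] --> B ->
  v t *m A t @[t --> F] --> b *m B.
Proof.
move=> vb AB; apply: cvg_mxP => i j; rewrite mxE.
under eq_fun do rewrite mxE.
apply: cvg_sum_ord => k.
by apply: cvgM; exact: cvg_coord.
Qed.

Lemma cvg_enormB {n : nat} {T : Type} {F : set_system T} {FF : Filter F}
    (u : T -> 'rV[R]_n) (a b : 'rV[R]_n) :
  u t @[t --> F] --> a -> enorm (u t - b) @[t --> F] --> enorm (a - b).
Proof.
move=> ua; apply: cvg_enorm.
by apply: cvgB => //; exact: cvg_cst.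
Qed.

Lemma cvg_enorm_close {n : nat} {T : Type} {F : set_system T} {FF : Filter F}
    (u v : T -> 'rV[R]_n) (eps : T -> R) (a : 'rV[R]_n) :
  u t @[t --> F] --> a -> eps t @[t --> F] --> 0 ->
  (forall t, enorm (v t - u t) <= eps t) -> v t @[t --> F] --> a.
Proof.
move=> ua eps0 vu.
have vu0 : v t - u t @[t --> F] --> (0 : 'rV[R]_n).
  apply: cvg_enorm0; under eq_fun do rewrite subr0.
  apply: (squeeze_cvgr _ (@cvg_cst _ _ _ _ _) eps0).
  by apply: filterE => t; rewrite enorm_ge0 vu.
have : (v t - u t) + u t @[t --> F] --> 0 + a by exact: cvgD.
by rewrite add0r; under eq_fun do rewrite subrK.
Qed.

End Euclidean.

(** * Projection onto a closed convex set *)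

Section Projection.
Context {R : realType} {m : nat}.
Implicit Types (C : set 'rV[R]_m) (y p z : 'rV[R]_m).

Lemma continuous_enormB (a : 'rV[R]_m) :
  continuous (fun z : 'rV[R]_m => enorm (z - a)).
Proof.
by move=> z; have := @cvg_enormB R m _ (nbhs z) _ id z a; apply; exact: cvg_id.
Qed.

Lemma compact_enorm_ball (a : 'rV[R]_m) (r : R) :
  compact [set z : 'rV[R]_m | enorm (z - a) <= r].
Proof.
apply: bounded_closed_compact.
  exists (`|a| + r); split; first exact: num_real.
  move=> M arM z /= zr; apply: le_trans (ltW arM).
  rewrite -(subrK a z) addrC (le_trans (ler_normD _ _))// lerD2l.
  exact: le_trans (norm_le_enorm _) zr.
by have := (continuous_closedP _).1 (@continuous_enormB a) _ (@closed_le R r).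
Qed.

(** Existence of the projection, characterised by the obtuse angle condition
    [y - p \in N(p)].  A nearest point exists by compactness of the points of
    [C] that are no farther from [y] than some fixed one; comparing it with
    [p + t (z - p)] for small [t > 0] gives the angle condition. *)
Lemma projection_ex C y : C !=set0 -> closed C -> convex_set C ->
  exists2 p, C p & normal_cone C p (y - p).
Proof.
move=> [z0 Cz0] Ccl Ccv.
pose A := C `&` [set z | enorm (z - y) <= enorm (z0 - y)].
have A0 : A !=set0 by exists z0; split => /=.
have Ac : compact A.
  rewrite /A setIC; apply: compact_closedI Ccl; exact: compact_enorm_ball.
have [p /set_mem[Cp /= pz0] pmin] := EVT_min_rV A0 Ac
  (continuous_subspaceT (@continuous_enormB y)).
have {}pmin z : C z -> dotv (y - p) (y - p) <= dotv (y - z) (y - z).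
  move=> Cz; rewrite -!enorm_sqr lerXn2r ?nnegrE ?enorm_ge0//.
  rewrite !(enormBC y).
  have [zz0|/ltW zz0] := leP (enorm (z - y)) (enorm (z0 - y)).
    by apply: pmin; apply/mem_set; split.
  exact: le_trans pz0 zz0.
exists p => // z Cz; move: pmin; set u := y - p; set w := z - p => pmin.
rewrite leNgt; apply/negP => d0.
set d := dotv u w in d0; set q := dotv w w.
have q0 : 0 <= q := dotvv_ge0 _.
(* a step [t] in (0, 1] at which the quadratic [t^2 q - 2 t d] is negative *)
pose t := d / (q + d).
have t0 : 0 < t by rewrite divr_gt0// ltr_wpDl.
have t1 : t <= 1 by rewrite ler_pdivrMr ?mul1r ?lerDr// ltr_wpDl.
have tq : t * q < 2 * d.
  rewrite /t mulrAC ltr_pdivrMr ?ltr_wpDl//; nra.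
have Ct : C (t *: z + (1 - t) *: p).
  by have /set_mem := Ccv z p (Itv01 (ltW t0) t1) (mem_set Cz) (mem_set Cp).
have := pmin _ Ct.
have -> : y - (t *: z + (1 - t) *: p) = u - t *: w.
  by apply/rowP => i; rewrite !mxE; ring.
rewrite (dotv_sqrB u (t *: w)) dotvZr dotvZl dotvZr -/d -/q.
have ttq : t * (t * q) < t * (2 * d) by rewrite ltr_pM2l.
apply/negP; rewrite -ltNge; lra.
Qed.

Lemma projection_dist_le C y p z : normal_cone C p (y - p) -> C z ->
  enorm (y - p) <= enorm (y - z).
Proof.
move=> Np Cz; rewrite -(@ler_pXn2r _ 2) ?nnegrE ?enorm_ge0// !enorm_sqr.
have -> : y - z = (y - p) - (z - p) by rewrite opprB addrA subrK.
have := Np _ Cz; have := dotvv_ge0 (z - p).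
rewrite (dotv_sqrB (y - p)); lra.
Qed.

Lemma dist_le C y z : C z -> dist C y <= enorm (y - z).
Proof.
move=> Cz; apply: ge_inf; last by exists z.
by exists 0 => _ [w _ <-]; exact: enorm_ge0.
Qed.

Lemma dist_projection C y p : C p -> normal_cone C p (y - p) ->
  dist C y = enorm (y - p).
Proof.
move=> Cp Np; apply/eqP; rewrite eq_le dist_le//=.
apply: lb_le_inf; first by exists (enorm (y - p)), p.
by move=> _ [z Cz <-]; exact: projection_dist_le Np Cz.
Qed.

(** Expanding the square around the projection [p] of [y]: using [p] as a
    competitor for [y + d] bounds the increment of the squared distance from
    above, the angle condition at [p] bounds it from below. *)
Lemma dist_sqr_expansion C y p d : closed C -> convex_set C ->
    C p -> normal_cone C p (y - p) ->
  0 <= dist C (y + d) ^+ 2 - dist C y ^+ 2 - dotv (2 *: (y - p)) d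
    <= enorm d ^+ 2.
Proof.
move=> Ccl Ccv Cp Np; rewrite (dist_projection Cp Np).
have [p' Cp' Np'] : exists2 p, C p & normal_cone C p (y + d - p).
  by apply: projection_ex => //; exists p.
have dle := projection_dist_le Np' Cp; have {Np} := Np _ Cp'.
rewrite (dist_projection Cp' Np').
move: dle; rewrite -(@ler_pXn2r _ 2) ?nnegrE ?enorm_ge0//.
have -> : y + d - p = (y - p) + d by rewrite addrAC.
have -> : y + d - p' = (y - p) + (d - (p' - p)).
  by apply/rowP => i; rewrite !mxE; ring.
set u := y - p; set w := p' - p; rewrite !enorm_sqr.
have := dotvv_ge0 (d - w).
rewrite (dotv_sqrD u (d - w)) (dotv_sqrD u d) dotvZl (dotvBr d w u).
move=> *; apply/andP; split; lra.
Qed.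

End Projection.

(** * Gradients as Frechet derivatives *)

Section Gradient.
Context {R : realType} {n : nat}.
Implicit Types (f : 'rV[R]_n -> R) (x u v g : 'rV[R]_n).

Lemma continuous_dotv g : continuous (dotv g).
Proof.
move=> x; have := @cvg_dotv R n _ (nbhs x) _ (cst g) id g x.
by apply; [exact: cvg_cst|exact: cvg_id].
Qed.

(** Gradients are taken with respect to [dotv], and remainders are measured in
    the Euclidean norm; this is the form in which subgradient inequalities and
    first-order conditions use differentiability. *)
Lemma is_diff_dotvP f x g :
  is_diff x f (dotv g) <->
  forall e, 0 < e -> \forall z \near x,
    `|f z - f x - dotv g (z - x)| <= e * enorm (z - x).
Proof.
have glin : linear (dotv g) by move=> a u v; rewrite dotvDr dotvZr.
pose gM := GRing.isLinear.Build _ _ _ _ _ glin.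
pose gL : {linear 'rV[R]_n -> R} := HB.pack (dotv g) gM.
split=> [[fx fg] e e0|fx].
  have [_ /eqaddoP fo] := (diff_locallyP _ _).1 fx.
  have {fo} : \forall d \near (0 : 'rV[R]_n),
    `|f (d + x) - (f x + dotv g d)| <= e * `|d| by rewrite -fg; exact: fo e e0.
  rewrite (near_shift x 0) => fo.
  apply: filterS fo => z /=; rewrite sub0r subrK opprD addrA => /le_trans; apply.
  by rewrite ler_wpM2l// ?norm_le_enorm// ltW.
have gc : continuous gL by exact: continuous_dotv.
have fo e : 0 < e -> \forall d \near (0 : 'rV[R]_n),
    `|f (d + x) - (f x + dotv g d)| <= e * `|d|.
  move=> e0; rewrite (near_shift x 0).
  have s0 : 0 < Num.sqrt n%:R + 1 :> R by rewrite ltr_wpDl ?sqrtr_ge0.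
  have := fx (e / (Num.sqrt n%:R + 1)) (divr_gt0 e0 s0).
  apply: filterS => z /=; rewrite sub0r subrK opprD addrA => /le_trans; apply.
  rewrite -mulrA ler_wpM2l ?(ltW e0)// ler_pdivrMl//.
  by rewrite (le_trans (enorm_le_norm _))// ler_wpM2r// lerDl.
have dfx : 'd f x = gL :> ('rV[R]_n -> R).
  by apply: diff_unique => //; apply/eqaddoP => e; exact: fo.
split=> //; apply/diff_locallyP; rewrite dfx; split=> //.
by apply/eqaddoP => e; exact: fo.
Qed.

Lemma grad_is_diff f x g : is_diff x f (dotv g) -> grad f x = g.
Proof.
move=> [fx fg]; apply/rowP => i.
by rewrite mxE deriveE// fg dotv_delta.
Qed.

Lemma is_diff_grad f x : differentiable f x -> is_diff x f (dotv (grad f x)).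
Proof.
move=> fx; split=> //; apply/funext => d.
rewrite [in LHS](row_sum_delta d) linear_sum/=; apply: eq_bigr => i _.
by rewrite linearZ/= mxE deriveE// mulrC.
Qed.

Lemma is_diff_dotv u x : is_diff x (dotv u) (dotv u).
Proof.
apply/is_diff_dotvP => e e0; apply: (@filterE _ (nbhs x)) => z.
by rewrite -dotvBr subrr normr0 mulr_ge0 ?enorm_ge0// ltW.
Qed.

Lemma is_diff_dotvD f f' x u v :
  is_diff x f (dotv u) -> is_diff x f' (dotv v) ->
  is_diff x (fun z => f z + f' z) (dotv (u + v)).
Proof.
move=> fu fv; have -> : dotv (u + v) = dotv u + dotv v.
  by apply/funext => d; rewrite dotvDl.
exact: is_diffD.
Qed.

Lemma is_diff_dotvZ f x u (a : R) :
  is_diff x f (dotv u) -> is_diff x (fun z => a * f z) (dotv (a *: u)).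
Proof.
move=> fu; have -> : dotv (a *: u) = a *: dotv u.
  by apply/funext => d; rewrite dotvZl.
exact: is_diffZ.
Qed.

Lemma near_ray x v (P : set 'rV[R]_n) : (\forall z \near x, P z) ->
  exists2 t : R, 0 < t & P (x + t *: v).
Proof.
move=> /nbhs_ballP[r /= r0 rP]; have v0 : 0 < 1 + `|v| by rewrite ltr_pwDl.
exists (r / (1 + `|v|)); first by rewrite divr_gt0.
apply: rP; rewrite -ball_normE/= opprD addNKr normrN normrZ.
rewrite gtr0_norm ?divr_gt0// mulrAC ltr_pdivrMr// ltr_pM2l//.
by rewrite ltrDr.
Qed.

(** First-order condition for a local minimum of [f + e |. - x|], obtained by
    moving from [x] in the direction opposite to the gradient. *)
Lemma approx_stationary f x g e : is_diff x f (dotv g) -> 0 <= e ->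
  (\forall z \near x, f x <= f z + e * enorm (z - x)) -> enorm g <= e.
Proof.
move=> /is_diff_dotvP fg e0 fmin; apply/ler_addgt0Pr => e' e'0.
have [t t0 [/=]] := near_ray (- g) (filterI (fg e' e'0) fmin).
have -> : x + t *: - g - x = t *: - g by rewrite addrAC subrr add0r.
rewrite enormZ enormN (gtr0_norm t0) dotvZr dotvNr -enorm_sqr.
rewrite ler_norml => /andP[_ le1] le2.
have : 0 <= t * (enorm g * (e + e' - enorm g)) by nra.
rewrite pmulr_rge0// => ge0.
have [g0|g0] := eqVneq (enorm g) 0; last first.
  by move: ge0; rewrite pmulr_rge0 ?subr_ge0// lt0r g0 enorm_ge0.
by rewrite g0 addr_ge0// ltW.
Qed.

End Gradient.

Section Chain.
Context {R : realType} {n m : nat}.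
Implicit Types (h : 'rV[R]_n -> 'rV[R]_m) (x : 'rV[R]_n) (u : 'rV[R]_m).

Lemma dotv_mxapp_tr (A : 'M[R]_(m, n)) u (d : 'rV[R]_n) :
  dotv (mxapp A^T u) d = dotv u (mxapp A d).
Proof. by rewrite !dotvE /mxapp trmxK trmx_mul trmxK mulmxA. Qed.

Lemma is_diff_jac h x : differentiable h x -> is_diff x h (mxapp (jac h x)).
Proof.
move=> hx; split=> //; apply/funext => d.
by rewrite /mxapp /jac trmxK /jacobian mul_rV_lin1.
Qed.

Lemma is_diff_dotv_comp (q : 'rV[R]_m -> R) h x u :
  differentiable h x -> is_diff (h x) q (dotv u) ->
  is_diff x (q \o h) (dotv (mxapp (jac h x)^T u)).
Proof.
move=> /is_diff_jac hx qu.
have -> : dotv (mxapp (jac h x)^T u) = dotv u \o mxapp (jac h x).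
  by apply/funext => d; rewrite dotv_mxapp_tr.
exact: is_diff_comp.
Qed.

Lemma dist_sqr_is_diff (C : set 'rV[R]_m) (y p : 'rV[R]_m) :
  closed C -> convex_set C -> C p -> normal_cone C p (y - p) ->
  is_diff y (fun z => dist C z ^+ 2) (dotv (2 *: (y - p))).
Proof.
move=> Ccl Ccv Cp Np; apply/is_diff_dotvP => e e0.
have ye : \forall z \near y, enorm (z - y) <= e.
  have := @continuous_enormB R m y y.
  rewrite /continuous_at subrr enorm0 => /cvgr0Pnorm_le/(_ e e0).
  by apply: filterS => z; exact: le_trans (ler_norm _).
apply: filterS ye => z ze.
have := dist_sqr_expansion (z - y) Ccl Ccv Cp Np.
rewrite [y + _]addrC subrK => /andP[ge0 le2].
rewrite ger0_norm// (le_trans le2)//.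
by rewrite expr2 ler_wpM2r ?enorm_ge0.
Qed.

Lemma penalty_is_diff (phi : 'rV[R]_n -> R) h (C : set 'rV[R]_m) (mu : R) x p :
  differentiable phi x -> differentiable h x ->
  closed C -> convex_set C -> C p -> normal_cone C p (h x - p) ->
  is_diff x (penalty phi h C mu)
    (dotv (grad phi x + mxapp (jac h x)^T (mu^-1 *: (h x - p)))).
Proof.
move=> phix hx Ccl Ccv Cp Np.
have := is_diff_dotvD (is_diff_grad phix) (is_diff_dotvZ (2 * mu)^-1
  (is_diff_dotv_comp hx (dist_sqr_is_diff Ccl Ccv Cp Np))).
congr (is_diff_def _ _ (dotv (_ + _))).
rewrite /mxapp !scalemxAl scalerA; congr (_ *: _ *m _).
by rewrite invfM mulrAC mulVf ?mul1r// pnatr_eq0.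
Qed.

End Chain.

(** * Closedness of the multiplier relation *)

Section Closure.
Context {R : realType}.

Lemma cluster_subsequence {n : nat} (u : nat -> 'rV[R]_n) (a : 'rV[R]_n) :
  cluster (u k @[k --> \oo]) a ->
  exists2 s : nat -> nat, s k @[k --> \oo] --> \oo &
    u (s k) @[k --> \oo] --> a.
Proof.
move=> ua.
have /choice[s sP] j : exists k, (j <= k)%N /\ `|a - u k| < j.+1%:R^-1.
  have uj : (u k @[k --> \oo]) [set u k | k in [set k | (j <= k)%N]].
    by exists j => // k /= jk; exists k.
  have aj : nbhs a (ball a j.+1%:R^-1) by apply: nbhsx_ballx; rewrite invr_gt0.
  have [_ [[k /= jk <-]]] := ua _ _ uj aj.
  by rewrite -ball_normE/= => ?; exists k.
exists s.
  apply/cvgnyPge => N; exists N => // k /= Nk.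
  by have [ks _] := sP k; exact: leq_trans ks.
apply/cvgrPdist_le => e e0; near=> k.
have [_ /ltW/le_trans] := sP k; apply; apply: ltW.
by near: k; exact: near_infty_natSinv_lt (PosNum e0).
Unshelve. all: by end_near. Qed.

(** The sequential closedness behind both halves of the theorem.  The points
    [u k := y k / (1 + |y k|)] stay in the unit ball, so a subsequence of them
    converges to some [a], normal to [C] at [q], and [B a = (1 - |a|) v] in the
    limit, because [1 - |u k| = 1 / (1 + |y k|)].  The constraint qualification excludes [|a| = 1], i.e. an escape of
    [y] to infinity, and then [a / (1 - |a|)] is the wanted multiplier. *)
Lemma multiplier_closure {n m : nat} (C : set 'rV[R]_m)
    (A : nat -> 'M[R]_(n, m)) (B : 'M[R]_(n, m)) (p y : nat -> 'rV[R]_m)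
    (q : 'rV[R]_m) (v : 'rV[R]_n) :
  A k @[k --> \oo] --> B -> p k @[k --> \oo] --> q ->
  (forall k, normal_cone C (p k) (y k)) ->
  mxapp (A k) (y k) @[k --> \oo] --> v ->
  nul B `&` normal_cone C q = [set 0] ->
  exists2 w, normal_cone C q w & mxapp B w = v.
Proof.
move=> AB pq Ny Ayv CQ.
pose u k := (1 + enorm (y k))^-1 *: y k.
have y1 k : 0 < 1 + enorm (y k) by rewrite ltr_pwDl ?enorm_ge0.
have uE k : enorm (u k) = 1 - (1 + enorm (y k))^-1.
  rewrite enormZ gtr0_norm ?invr_gt0//.
  apply: (mulfI (lt0r_neq0 (y1 k))).
  by rewrite mulrA mulrBr mulfV ?gt_eqF//; ring.
have u1 : (u k @[k --> \oo]) [set z | enorm (z - 0) <= 1].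
  by exists 0%N => // k _ /=; rewrite subr0 uE gerBl invr_ge0 ltW.
have [a [_ /cluster_subsequence[s soo ua]]] :=
  @compact_enorm_ball R m 0 1 (u k @[k --> \oo]) _ u1.
have ta : 1 - enorm (u (s k)) @[k --> \oo] --> 1 - enorm a.
  by apply: cvgB; [exact: cvg_cst|exact: cvg_enorm].
have Na : normal_cone C q a.
  move=> z Cz.
  have zq : z - p (s k) @[k --> \oo] --> z - q.
    by apply: cvgB; [exact: cvg_cst|exact: cvg_comp soo pq].
  apply: (cvgr_to_le (cvg_dotv ua zq)).
  apply: nearW => k; rewrite dotvZl pmulr_rle0 ?invr_gt0//; exact: Ny.
have Ba : mxapp B a = (1 - enorm a) *: v.
  have BT : (A (s k))^T @[k --> \oo] --> B^T.
    by apply: cvg_trmx; exact: cvg_comp soo AB.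
  have Bua : mxapp (A (s k)) (u (s k)) @[k --> \oo] --> mxapp B a.
    exact: cvg_mulmx.
  have tv : (1 - enorm (u (s k))) *: mxapp (A (s k)) (y (s k)) @[k --> \oo]
      --> (1 - enorm a) *: v.
    by apply: cvgZ => //; exact: cvg_comp soo Ayv.
  apply: (norm_cvg_unique Bua); apply: cvg_trans tv.
  apply: near_eq_cvg; apply: nearW => k /=.
  by rewrite uE opprB addrC subrK /u /mxapp -scalemxAl.
have t0 : 1 - enorm a != 0.
  apply/eqP => t0; have : (nul B `&` normal_cone C q) a.
    by split => //; rewrite /nul/= Ba t0 scale0r.
  by rewrite CQ => a0; move: t0; rewrite a0 enorm0 subr0; exact/eqP/oner_neq0.
have t1 : 0 <= 1 - enorm a.
  apply: (cvgr_to_ge ta).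
  by apply: nearW => k /=; rewrite uE opprB addrC subrK invr_ge0 ltW.
exists ((1 - enorm a)^-1 *: a).
  by move=> z Cz; rewrite dotvZl mulr_ge0_le0 ?invr_ge0//; exact: Na.
by rewrite /mxapp -scalemxAl -/(mxapp B a) Ba scalerA mulVf ?scale1r.
Qed.

End Closure.

(** * Approximate multipliers by penalization *)

Section Penalization.
Context {R : realType} {n m : nat}.

Lemma near_enorm_ball {k : nat} (x : 'rV[R]_k) (P : set 'rV[R]_k) :
  (\forall z \near x, P z) ->
  exists2 r, 0 < r & forall z, enorm (z - x) <= r -> P z.
Proof.
move=> /nbhs_ballP[r /= r0 rP]; exists (r / 2); first by rewrite divr_gt0.
move=> z zr; apply: rP; rewrite -ball_normE/= distrC.
rewrite (le_lt_trans (norm_le_enorm _))// (le_lt_trans zr)//.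
by rewrite ltr_pdivrMr// ltr_pMr// ltr1n.
Qed.

(** The penalty method applied at a point [x0] where [w] is a regular normal
    to [h^-1(C)].  For a small radius [r], [x0] is the only feasible point in the
    ball of radius [r] where [L z = - w.(z - x0) + e |z - x0|] is nonpositive.
    Minimizing [L + c dist^2(h(.)|C)] over that ball with a weight [c] so large
    that the sphere is excluded gives an interior minimizer [z], at which
    stationarity reads [|w - h'(z)^T y| <= e] with [y = 2 c (h z - p)] and [p]
    the projection of [h z]. *)
Lemma regular_normal_multiplier (h : 'rV[R]_n -> 'rV[R]_m) (C : set 'rV[R]_m)
    (x0 w : 'rV[R]_n) :
  (forall x, differentiable h x) -> closed C -> convex_set C -> C (h x0) ->
  (forall e, 0 < e -> \forall z \near x0,
     C (h z) -> dotv w (z - x0) <= e * enorm (z - x0)) ->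
  forall e, 0 < e -> exists z p y,
    [/\ enorm (z - x0) <= e, enorm (p - h x0) <= e, normal_cone C p y &
        enorm (w - mxapp (jac h z)^T y) <= e].
Proof.
move=> hd Ccl Ccv Cx0 wN e e0.
have proj z : exists2 p, C p & normal_cone C p (h z - p).
  by apply: projection_ex => //; exists (h x0).
have e2 : 0 < e / 2 by rewrite divr_gt0.
have [r r0 rP] : exists2 r, 0 < r & forall z, enorm (z - x0) <= r ->
    [/\ enorm (z - x0) <= e, enorm (h z - h x0) <= e / 2 &
        C (h z) -> dotv w (z - x0) <= e / 2 * enorm (z - x0)].
  have hc : \forall z \near x0, enorm (h z - h x0) <= e / 2.
    have hx0 : h z @[z --> x0] --> h x0 by exact: differentiable_continuous.
    have : enorm (h z - h x0) @[z --> x0] --> enorm (h x0 - h x0).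
      exact: (@cvg_enormB R m _ (nbhs x0) _ h (h x0) (h x0) hx0).
    rewrite subrr enorm0.
    move=> /cvgr0Pnorm_le/(_ _ e2).
    by apply: filterS => z; exact: le_trans (ler_norm _).
  have [r r0 rP] := near_enorm_ball (filterI hc (wN _ e2)).
  exists (Num.min r e); first by rewrite lt_min r0.
  by move=> z; rewrite le_min => /andP[/rP[]].
pose B := [set z : 'rV[R]_n | enorm (z - x0) <= r].
pose L z := e * enorm (z - x0) - dotv w (z - x0).
pose D z := dist C (h z) ^+ 2.
have D_diff z p : C p -> normal_cone C p (h z - p) ->
    is_diff z D (dotv (mxapp (jac h z)^T (2 *: (h z - p)))).
  move=> Cp Np.
  exact: (is_diff_dotv_comp (hd z) (dist_sqr_is_diff Ccl Ccv Cp Np)).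
have Dc : continuous D.
  move=> z; have [p Cp Np] := proj z; have := D_diff z p Cp Np.
  by move=> ?; apply: differentiable_continuous; exact: ex_diff.
have Lc : continuous L.
  move=> z; have zx0 : z' - x0 @[z' --> z] --> z - x0.
    exact: (cvgB (@cvg_id _ _) (@cvg_cst _ _ _ _ _)).
  have wc : dotv w (z' - x0) @[z' --> z] --> dotv w (z - x0).
    exact: (continuous_cvg _ (@continuous_dotv R n w (z - x0)) zx0).
  have ec := @continuous_enormB R n x0 z.
  have {}ec : e * enorm (z' - x0) @[z' --> z] --> e * enorm (z - x0).
    exact: (cvgMr ec).
  exact: (cvgB ec wc).
have Bc : compact B by exact: compact_enorm_ball.
have D_ge0 z : 0 <= D z by exact: sqr_ge0.
have [c c0 cP] : exists2 c, 0 <= c &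
    forall z, enorm (z - x0) = r -> 0 < L z + c * D z.
  (* [D] is bounded below by a positive constant on the part [K] of the sphere
     where [L] is nonpositive, because [K] is compact and has no feasible point;
     elsewhere on the sphere [L] is already positive *)
  pose K := B `&` [set z | enorm (z - x0) = r /\ L z <= 0].
  have Kc : compact K.
    apply: compact_closedI => //; apply: closedI.
      by have := (continuous_closedP _).1 (@continuous_enormB R n x0) _
        (@closed_eq R r).
    by have := (continuous_closedP _).1 Lc _ (@closed_le R 0).
  have [K0|/nonemptyPn K0] := pselect (K !=set0); last first.
    exists 0 => // z zr; rewrite mul0r addr0 ltNge; apply/negP => Lz.
    suff : K z by rewrite K0.
    by split => //; rewrite /B/= zr.
  have [z1 /set_mem[_ [z1r Lz1]] z1min] := EVT_min_rV K0 Kc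
    (continuous_subspaceT Dc).
  have D1 : 0 < D z1.
    rewrite lt_neqAle D_ge0 andbT eq_sym; apply/eqP => D0.
    have [p Cp Np] := proj z1.
    have hp : h z1 = p.
      apply/eqP; rewrite -subr_eq0; apply/eqP/enorm_eq0.
      rewrite -(dist_projection Cp Np).
      by apply/eqP; rewrite -sqrf_eq0; exact/eqP.
    have [|_ _] := rP z1; first by rewrite z1r.
    rewrite hp z1r => /(_ Cp) le1; move: Lz1; rewrite /L z1r => le2.
    have := mulr_gt0 e2 r0; nra.
  have wr0 : 0 <= enorm w * r by rewrite mulr_ge0 ?enorm_ge0// ltW.
  (* [L] is at least [- |w| r] on the sphere *)
  exists ((enorm w * r + 1) / D z1).
    by rewrite divr_ge0// addr_ge0.
  move=> z zr; have [Lz|Lz] := leP (L z) 0; last first.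
    by rewrite ltr_wpDr// mulr_ge0// divr_ge0// addr_ge0.
  have Kz : K z by split => //; rewrite /B/= zr.
  have cD : enorm w * r + 1 <= (enorm w * r + 1) / D z1 * D z.
    rewrite -mulrA ler_peMr ?addr_ge0// mulrC ler_pdivlMr// mul1r.
    by apply: z1min; exact: mem_set.
  have := dotv_le_enorm w (z - x0); rewrite zr => wz.
  have := mulr_ge0 (ltW e0) (ltW r0).
  by move: cD; rewrite /L zr; lra.
pose g z := L z + c * D z.
have gc : continuous g.
  by move=> z; exact: (cvgD (Lc z) (cvgMr (Dc z))).
have Bx0 : B x0 by rewrite /B/= subrr enorm0 ltW.
have [z /set_mem Bz zmin] := EVT_min_rV (ex_intro _ x0 Bx0) Bc
  (continuous_subspaceT gc).
have gx0 : g x0 = 0.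
  rewrite /g /L /D subrr enorm0 dotv0r mulr0 subr0 add0r.
  have N0 : normal_cone C (h x0) (h x0 - h x0).
    by move=> y _; rewrite subrr dotv0l.
  by rewrite (dist_projection Cx0 N0) subrr enorm0 expr0n mulr0.
have gz0 : g z <= 0 by rewrite -gx0; apply: zmin; exact: mem_set.
have zr : enorm (z - x0) < r.
  rewrite lt_neqAle Bz andbT; apply/eqP => zr.
  by have := cP z zr; rewrite ltNge gz0.
have [ze hze _] := rP z Bz.
have [p Cp Np] := proj z.
exists z, p, (c *: (2 *: (h z - p))); split => //.
- (* [p] is no farther from [h z] than the feasible point [h x0] *)
  have -> : p - h x0 = (h z - h x0) - (h z - p).
    by apply/rowP => i; rewrite !mxE; ring.
  rewrite (le_trans (enorm_triangle _ _))// enormN.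
  have := projection_dist_le Np Cx0; lra.
- move=> y Cy; rewrite !dotvZl mulr_ge0_le0// mulr_ge0_le0//.
  exact: Np.
have f_diff := is_diff_dotvD (is_diff_dotv (- w) z)
  (is_diff_dotvZ c (D_diff z p Cp Np)).
rewrite -enormN opprB addrC.
rewrite [mxapp _ (c *: _)]/mxapp -scalemxAl.
apply: (approx_stationary f_diff (ltW e0)).
have Bnear : \forall z' \near z, enorm (z' - x0) < r.
  exact: (cvgr_lt _ (@continuous_enormB R n x0 z) _ zr).
apply: filterS Bnear => z' /ltW Bz'.
have := zmin z' (mem_set Bz').
have tri : enorm (z' - x0) <= enorm (z' - z) + enorm (z - x0).
  by rewrite (le_trans _ (enorm_triangle _ _))// addrA subrK.
have := ler_wpM2l (ltW e0) tri.
rewrite /g /L !dotvBr !dotvNl; lra.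
Qed.

End Penalization.

(** * The constrained problem *)

Section Constrained.
Context {R : realType} {n m : nat}.
Context (phi : 'rV[R]_n -> R) (h : 'rV[R]_n -> 'rV[R]_m) (C : set 'rV[R]_m).
Implicit Types (x v : 'rV[R]_n) (y : 'rV[R]_m).

Lemma constrained_in x : C (h x) -> constrained phi h C x = (phi x)%:E.
Proof. by move=> Cx; rewrite /constrained /delta mem_set// adde0. Qed.

Lemma constrained_notin x : ~ C (h x) -> constrained phi h C x = +oo%E.
Proof. by move=> Cx; rewrite /constrained /delta memNset. Qed.

(** On the feasible set [y.(h z - h x) <= 0], so [f] lies above the smooth
    function [phi + y.(h - h x)], with equality at [x]. *)
Lemma multiplier_regular_subdiff x y :
  differentiable phi x -> differentiable h x -> C (h x) ->
  normal_cone C (h x) y ->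
  regular_subdiff (constrained phi h C) x (grad phi x + mxapp (jac h x)^T y).
Proof.
move=> phix hx Cx Ny.
have /is_diff_dotvP psi := is_diff_dotvD (is_diff_grad phix)
  (is_diff_dotv_comp hx (is_diff_dotv y (h x))).
rewrite /regular_subdiff/= (constrained_in Cx) ltry; split=> //.
set v := (grad phi x + _) in psi *.
exists (fun z => phi z + (dotv y \o h) z - (phi x + (dotv y \o h) x)
                 - dotv v (z - x)).
  apply/eqoP => e e0; apply: filterS (psi e e0) => z.
  by rewrite [X in _ -> _ <= _ * X]ger0_norm ?enorm_ge0.
apply: (@filterE _ (nbhs x)) => z /=.
have [Cz|Cz] := pselect (C (h z)); last by rewrite (constrained_notin Cz) leey.
rewrite (constrained_in Cz) -EFinD lee_fin.
have := Ny _ Cz; rewrite dotvBr; lra.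
Qed.

Lemma regular_subdiff_feasible x v :
  regular_subdiff (constrained phi h C) x v -> C (h x).
Proof.
move=> [xoo _]; apply: contrapT => Cx.
by rewrite (constrained_notin Cx) in xoo.
Qed.

Lemma regular_subdiff_normal x v : differentiable phi x ->
  regular_subdiff (constrained phi h C) x v ->
  forall e, 0 < e -> \forall z \near x,
    C (h z) -> dotv (v - grad phi x) (z - x) <= e * enorm (z - x).
Proof.
move=> phix vx e e0; have Cx := regular_subdiff_feasible vx.
have [_ [r /eqoP ro xr]] := vx.
have e2 : 0 < e / 2 by rewrite divr_gt0.
have /is_diff_dotvP/(_ _ e2) phio := is_diff_grad phix.
apply: filterS (filterI (filterI (ro _ e2) phio) xr) => z [[rz phiz] fz] Cz.
move: rz phiz fz; rewrite (constrained_in Cx) (constrained_in Cz).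
rewrite -EFinD lee_fin (ger0_norm (enorm_ge0 _)) !ler_norml dotvBl.
by move=> /andP[? ?] /andP[? ?] ?; lra.
Qed.

Context (phi_diff : forall x, differentiable phi x)
  (phi_C1 : continuous (grad phi))
  (h_diff : forall x, differentiable h x) (h_C1 : continuous (jac h))
  (C_closed : closed C) (C_convex : convex_set C).

Lemma cvg_jac_tr (z : nat -> 'rV[R]_n) x : z k @[k --> \oo] --> x ->
  (jac h (z k))^T @[k --> \oo] --> (jac h x)^T.
Proof.
move=> zx; have jzx : jac h (z k) @[k --> \oo] --> jac h x.
  exact: (continuous_cvg _ (@h_C1 x) zx).
exact: cvg_trmx jzx.
Qed.

Lemma cvg_grad (z : nat -> 'rV[R]_n) x : z k @[k --> \oo] --> x ->
  grad phi (z k) @[k --> \oo] --> grad phi x.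
Proof. by move=> zx; exact: (continuous_cvg _ (@phi_C1 x) zx). Qed.

(** Each regular subgradient at [x k] has a multiplier up to an error
    [1/(k+1)], at points within [1/(k+1)] of [x k] and [h (x k)]; the closedness
    of the multiplier relation turns these into an exact one in the limit. *)
Lemma limiting_subdiff_multiplier x v :
  nul (jac h x)^T `&` normal_cone C (h x) = [set 0] ->
  limiting_subdiff (constrained phi h C) x v ->
  exists2 y, normal_cone C (h x) y &
    grad phi x + mxapp (jac h x)^T y = v.
Proof.
move=> CQ [u [w [ux _ wu wv]]].
pose eps k : R := k.+1%:R^-1.
have eps0 k : 0 < eps k by rewrite invr_gt0.
have eps_cvg : eps k @[k --> \oo] --> 0 by exact: cvg_harmonic.
have /choice[z /choice[p /choice[y zpy]]] k : exists z p y,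
    [/\ enorm (z - u k) <= eps k, enorm (p - h (u k)) <= eps k,
        normal_cone C p y &
        enorm (w k - grad phi (u k) - mxapp (jac h z)^T y) <= eps k].
  apply: regular_normal_multiplier => //.
    exact: regular_subdiff_feasible (wu k).
  exact: regular_subdiff_normal.
have zu k : enorm (z k - u k) <= eps k by have [] := zpy k.
have ph k : enorm (p k - h (u k)) <= eps k by have [] := zpy k.
have Ny k : normal_cone C (p k) (y k) by have [] := zpy k.
have zx : z k @[k --> \oo] --> x by exact: (cvg_enorm_close ux eps_cvg zu).
have hux : h (u k) @[k --> \oo] --> h x.
  exact: (continuous_cvg _ (differentiable_continuous (h_diff x)) ux).
have px : p k @[k --> \oo] --> h x by exact: (cvg_enorm_close hux eps_cvg ph).
have wg : w k - grad phi (u k) @[k --> \oo] --> v - grad phi x.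
  by apply: cvgB => //; exact: cvg_grad.
have Jy : mxapp (jac h (z k))^T (y k) @[k --> \oo] --> v - grad phi x.
  apply: (cvg_enorm_close wg eps_cvg) => k.
  by rewrite enormBC; have [] := zpy k.
have [q Nq qv] := multiplier_closure (cvg_jac_tr zx) px Ny Jy CQ.
by exists q => //; rewrite qv addrC subrK.
Qed.

(** The subdifferential formula: equality holds because every element of the
    right-hand side is even a regular subgradient at the point itself. *)
Lemma limiting_subdiff_constrained x : C (h x) ->
  nul (jac h x)^T `&` normal_cone C (h x) = [set 0] ->
  limiting_subdiff (constrained phi h C) x =
    [set grad phi x + mxapp (jac h x)^T y | y in normal_cone C (h x)].
Proof.
move=> Cx CQ; apply/seteqP; split=> [v /(limiting_subdiff_multiplier CQ)|].
  by move=> [y Ny <-]; exists y.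
move=> _ [y Ny <-]; exists (fun=> x), (fun=> grad phi x + mxapp (jac h x)^T y).
split=> [||k|]; try exact: cvg_cst.
exact: multiplier_regular_subdiff.
Qed.

(** The multiplier estimates of the penalty method are
    [y k = (h (x k) - p k) / mu k], with [p k] the projection of [h (x k)]:
    they lie in [N(p k)], and [grad phi (x k) + h'(x k)^T (y k)] is the gradient
    of the penalty function, which vanishes in the limit. *)
Lemma penalty_limit_multiplier (u : nat -> 'rV[R]_n) (mu : nat -> R) x :
  (forall k, 0 < mu k) -> u k @[k --> \oo] --> x ->
  enorm (grad (penalty phi h C (mu k)) (u k)) @[k --> \oo] --> 0 ->
  C (h x) -> nul (jac h x)^T `&` normal_cone C (h x) = [set 0] ->
  exists2 y, normal_cone C (h x) y & grad phi x + mxapp (jac h x)^T y = 0.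
Proof.
move=> mu0 ux g0 Cx CQ.
have /choice[p pP] k : exists p, C p /\ normal_cone C p (h (u k) - p).
  have [|p ? ?] := @projection_ex R m C (h (u k)) _ C_closed C_convex.
    by exists (h x).
  by exists p.
pose y k := (mu k)^-1 *: (h (u k) - p k).
have Ny k : normal_cone C (p k) (y k).
  move=> z Cz; rewrite dotvZl pmulr_rle0 ?invr_gt0//.
  by have [_] := pP k; exact.
have hux : h (u k) @[k --> \oo] --> h x.
  exact: (continuous_cvg _ (differentiable_continuous (h_diff x)) ux).
have px : p k @[k --> \oo] --> h x.
  have hx0 : enorm (h (u k) - h x) @[k --> \oo] --> 0.
    by rewrite -(enorm0 (n := m)) -(subrr (h x)); exact: cvg_enormB.
  apply: (cvg_enorm_close hux hx0) => k; rewrite enormBC.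
  by have [_ /projection_dist_le] := pP k; exact.
have gE k : grad (penalty phi h C (mu k)) (u k) =
    grad phi (u k) + mxapp (jac h (u k))^T (y k).
  by have [Cp Np] := pP k; apply: grad_is_diff; exact: penalty_is_diff.
have Jy : mxapp (jac h (u k))^T (y k) @[k --> \oo] --> - grad phi x.
  have gx : - grad phi (u k) @[k --> \oo] --> - grad phi x.
    by apply: cvgN; exact: cvg_grad.
  apply: (cvg_enorm_close gx g0) => k.
  by rewrite opprK addrC -gE.
have [q Nq qv] := multiplier_closure (cvg_jac_tr ux) px Ny Jy CQ.
by exists q => //; rewrite qv subrr.
Qed.

End Constrained.

Theorem theorem6p1 (R : realType) (n m : nat)
  (phi : 'rV[R]_n -> R) (h : 'rV[R]_n -> 'rV[R]_m) (C : set 'rV[R]_m)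
  (phi_diff : forall x, differentiable phi x)
  (phi_C1 : continuous (grad phi))
  (h_diff : forall x, differentiable h x)
  (h_C1 : continuous (jac h))
  (C_nonempty : C !=set0) (C_closed : closed C) (C_convex : convex_set C)
  (x : nat -> 'rV[R]_n) (mu : nat -> R)
  (mu_gt0 : forall k, 0 < mu k)
  (mu_to0 : mu k @[k --> \oo] --> 0)
  (grad_to0 : enorm (grad (penalty phi h C (mu k)) (x k)) @[k --> \oo] --> 0)
  (xbar : 'rV[R]_n)
  (xbar_cluster : cluster (x k @[k --> \oo]) xbar)
  (xbar_feasible : C (h xbar))
  (xbar_CQ : nul (jac h xbar)^T `&` normal_cone C (h xbar) = [set 0]) :
  limiting_subdiff (constrained phi h C) xbar 0 /\
  limiting_subdiff (constrained phi h C) xbar =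
    [set grad phi xbar + mxapp (jac h xbar)^T y | y in normal_cone C (h xbar)].
Proof.
have subdiffE := limiting_subdiff_constrained phi_diff phi_C1 h_diff h_C1
  C_closed C_convex xbar_feasible xbar_CQ.
split=> //; rewrite subdiffE.
have [s soo sx] := cluster_subsequence xbar_cluster.
have [y Ny y0] := penalty_limit_multiplier phi_diff phi_C1 h_diff h_C1
  C_closed C_convex (mu := mu \o s) (fun k => mu_gt0 (s k)) sx
  (cvg_comp _ _ soo grad_to0) xbar_feasible xbar_CQ.
by exists y.
Qed.
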